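(* Let $G=(V,E)$ be a locally finite and connected graph with symmetric weight and uniformly positive measure, let $2\le p<\infty$, and let $\Omega$ be a non-empty, connected and bounded domain in $V$. Then the Dirichlet problem $$-\Delta u+u=|u|^{p-1}u\ \text{ in }\Omega,\qquad u=0\ \text{ on }\partial\Omega$$ has a ground state solution $u_0\in W_0^{1,2}(\Omega)$.
   Context: A graph $G=(V,E)$ is locally finite if each $x\in V$ has only finitely many $y\in V$ with $xy\in E$; it is connected if any two vertices can be joined by finitely many edges. Each edge $xy\in E$ has a weight $w_{xy}>0$, symmetric if $w_{xy}=w_{yx}$. The measure $\mu:V\to(0,\infty)$ is uniformly positive if there is $\mu_{\min}>0$ with $\mu(x)\ge\mu_{\min}$ for all $x\in V$. The distance $d(x,y)$ is the minimal number of edges connecting $x$ and $y$. A domain is a subset $\Omega\subset V$; it is bounded if $d(x,y)$ is uniformly bounded above for $x,y\in\Omega$. Its boundary is $\partial\Omega=\{y\notin\Omega:\exists x\in\Omega\text{ with }xy\in E\}$. Write $y\sim x$ if $xy\in E$. For functions $u,v:V\to\mathbb{R}$: $$\Delta u(x)=\frac1{\mu(x)}\sum_{y\sim x}w_{xy}(u(y)-u(x)),\quad \Gamma(u,v)(x)=\frac1{2\mu(x)}\sum_{y\sim x}w_{xy}(u(y)-u(x))(v(y)-v(x)),\quad |\nabla u|^2=\Gamma(u,u),$$ and $\int_A u\,d\mu=\sum_{x\in A}\mu(x)u(x)$ for $A\subset V$. $C_c(\Omega)$ is the set of functions with finite (compact) support in $\Omega$, extended by zero to $V$; $W_0^{1,2}(\Omega)$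 is its completion under $$\|u\|_{W_0^{1,2}(\Omega)}=\left(\int_{\Omega\cup\partial\Omega}|\nabla u|^2d\mu+\int_\Omega u^2d\mu\right)^{1/2}.$$ Let $J_\Omega(u)=\frac12\|u\|_{W_0^{1,2}(\Omega)}^2-\frac1{p+1}\int_\Omega|u|^{p+1}d\mu$, $\mathcal{N}_\Omega=\{u\in W_0^{1,2}(\Omega)\setminus\{0\}:\|u\|_{W_0^{1,2}(\Omega)}^2=\int_\Omega|u|^{p+1}d\mu\}$ and $m_\Omega=\inf_{u\in\mathcal{N}_\Omega}J_\Omega(u)$. A weak solution of the Dirichlet problem is $u\in W_0^{1,2}(\Omega)$ with $\int_{\Omega\cup\partial\Omega}\Gamma(u,\varphi)\,d\mu+\int_\Omega u\varphi\,d\mu=\int_\Omega|u|^{p-1}u\varphi\,d\mu$ for all $\varphi\in C_c(\Omega)$. A ground state solution is a weak solution $u_0\in\mathcal{N}_\Omega$ with $J_\Omega(u_0)=m_\Omega$. *)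

(* Defs.v *)
From HB Require Import structures.
From mathcomp Require Import all_boot all_order all_algebra.
From mathcomp Require Import all_classical all_reals all_analysis.
Import Order.TTheory GRing.Theory Num.Theory.
Import numFieldNormedType.Exports.

Set Implicit Arguments.
Unset Strict Implicit.
Unset Printing Implicit Defensive.

Local Open Scope classical_set_scope.
Local Open Scope ring_scope.

Section Graph.
Context {V : choiceType}.
Implicit Types (E : rel V) (A : set V).

Definition neighbours E (x : V) : set V := [set y | E x y].

Definition locally_finite E := forall x, finite_set (neighbours E x).

(* [x :: s] is a walk from [x] to [y]; it uses [size s] edges. *)
Definition walk E (x y : V) (s : seq V) := path E x s /\ last x s = y.

(* Connectedness of the subgraph induced on [A]. *)
Definition connected_in E A :=
  forall x y, A x -> A y ->
  exists s, walk E x y s /\ forall z, z \in s -> A z.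

Definition connected_graph E := connected_in E setT.

(* The default value 0 is only used for pairs not joined by any walk, which do
   not exist in a connected graph. *)
Definition dist E (x y : V) : nat :=
  xget 0%N [set n | (exists s, walk E x y s /\ size s = n) /\
                    (forall s, walk E x y s -> (n <= size s)%N)].

Definition bounded_domain E A :=
  exists N : nat, forall x y, A x -> A y -> (dist E x y <= N)%N.

Definition boundary E A : set V :=
  [set y | ~ A y /\ exists2 x, A x & E x y].

End Graph.

Section Calculus.
Context {R : realType} {V : choiceType}.
Variables (E : rel V) (w : V -> V -> R) (mu : V -> R).
Implicit Types (u v phi : V -> R) (A Omega : set V).

Definition uniformly_positive :=
  exists2 mu_min : R, 0 < mu_min & forall x, mu_min <= mu x.

(* A finite sum as soon as the graph is locally finite. *)
Definition Gamma u v (x : V) : R :=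
  (2 * mu x)^-1 *
  \sum_(y \in neighbours E x) w x y * (u y - u x) * (v y - v x).

(* [\esum] is only meant for nonnegative families, hence the splitting into
   positive and negative parts; the value is extended real because [A] may be
   infinite. *)
Definition integral_on A u : \bar R :=
  let f := fun x => (mu x * u x)%:E in
  (\esum_(x in A) f^\+ x - \esum_(x in A) f^\- x)%E.

Definition normW Omega u : \bar R :=
  ((integral_on (Omega `|` boundary E Omega) (Gamma u u)
    + integral_on Omega (fun x => u x ^+ 2)%R) `^ 2^-1)%E.

Definition Cc Omega : set (V -> R) :=
  [set phi | finite_set [set x | phi x != 0] /\
             [set x | phi x != 0] `<=` Omega].

(* The completion of [Cc Omega] realized as a space of functions on [V].  Since
   mu x * u x ^+ 2 <= normW Omega u ^+ 2 for x in Omega and mu x > 0, Cauchy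
   sequences in [Cc Omega] converge pointwise, and in norm, to their pointwise
   limit; so the completion is the closure of [Cc Omega] among the functions
   that vanish outside Omega. *)
Definition W012 Omega : set (V -> R) :=
  [set u | (forall x, ~ Omega x -> u x = 0) /\
           exists phi : nat -> V -> R,
             (forall n, Cc Omega (phi n)) /\
             (fun n => normW Omega (u \- phi n)) @ \oo --> 0%E].

Variable p : R.

Definition integral_pow Omega u : \bar R :=
  integral_on Omega (fun x => `|u x| `^ (p + 1)).

Definition J Omega u : \bar R :=
  ((2^-1)%:E * normW Omega u ^+ 2
   - ((p + 1)^-1)%:E * integral_pow Omega u)%E.

Definition Nehari Omega : set (V -> R) :=
  [set u | [/\ W012 Omega u, u <> cst 0 &
               (normW Omega u ^+ 2)%E = integral_pow Omega u]].

Definition ground_level Omega : \bar R := ereal_inf (J Omega @` Nehari Omega).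

(* Weak solutions of - Delta u + u = |u|^(p-1) u in Omega, with u = 0 on the
   boundary of Omega. *)
Definition weak_solution Omega u :=
  W012 Omega u /\
  forall phi, Cc Omega phi ->
    (integral_on (Omega `|` boundary E Omega) (Gamma u phi)
     + integral_on Omega (fun x => u x * phi x)%R
     = integral_on Omega (fun x => `|u x| `^ (p - 1) * u x * phi x)%R)%E.

Definition ground_state_solution Omega u :=
  [/\ weak_solution Omega u, Nehari Omega u & J Omega u = ground_level Omega].

End Calculus.

(* Main.v *)
Require Import Defs.
From mathcomp Require Import all_boot all_order all_algebra.
From mathcomp Require Import all_classical all_reals all_analysis.
From mathcomp Require Import finmap ring lra.
Import Order.TTheory GRing.Theory Num.Theory.
Import numFieldNormedType.Exports.
Local Open Scope classical_set_scope.
Local Open Scope ring_scope.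

(** Balls of a locally finite graph are finite, so a bounded domain Omega is a
    finite set ([bounded_domain_finite]).  Every integral is then a finite sum,
    and both [Cc Omega] and [W012 Omega] are the finite-dimensional space of all
    functions that vanish outside Omega ([CcE], [W012E]).

    Let N(u) be the squared norm ([energy]), B its polar form, and P(u) the
    integral of |u|^(p+1) ([power_integral]).  The sphere N = 1 is compact, so P
    attains its maximum S > 0 there, at some v.  By homogeneity
      P(u) <= S N(u)^((p+1)/2)   for all u   ([best_constant]),
    with equality at v.  Comparing both sides along the line v + t phi, that is,
    taking the first variation at v, gives
      S B(v, phi) = int |v|^(p-1) v phi   ([euler_lagrange]).
    Take u0 = t v with t^(p-1) = 1/S.  Since the right-hand side is homogeneous
    of degree p in v and the left-hand side of degree 1, u0 is a weak solution
    of the equation, and it lies on the Nehari set.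

    On the Nehari set J = (1/2 - 1/(p+1)) N ([JE_Nehari]), so it remains to see
    that u0 minimises N there.  If N(u) = P(u) with u nonzero, the inequality
    above gives N(u)^((p-1)/2) >= 1/S = t^(p-1), hence N(u) >= t^2 = N(u0).

    The only delicate point is the first variation, as |x|^(p+1) is not smooth
    at 0.  Only one-sided bounds are used: P lies above its tangent, by
    convexity ([powR_tangent]), and N^((p+1)/2) lies below an exponential, by
    1 + s <= exp s; these two smooth bounds touch at t = 0
    ([expR_line_contact]). *)

(** * Bounded domains are finite *)

Section FiniteDomain.
Context {V : choiceType} (E : rel V).

(** In a connected graph the set that defines [dist] is nonempty, so its default
    value is never taken. *)
Lemma dist_walk (x y : V) : connected_graph E ->
  exists2 s, walk E x y s & size s = dist E x y.
Proof.
move=> Econn; pose P n := `[< exists s, walk E x y s /\ size s = n >].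
have exP : exists n, P n.
  have [s [xys _]] := Econn x y I I.
  by exists (size s); apply/asboolP; exists s.
rewrite /dist; case: xgetP => [n _ [[s [xys <-]] _]|]; first by exists s.
case: (ex_minnP exP) => n /asboolP Pn minn /(_ n); case; split=> // s xys.
by apply: minn; apply/asboolP; exists s.
Qed.

(** Removing the last edge of a walk: the ends of the walks of length n.+1 are
    neighbours of the finitely many ends of the walks of length n. *)
Lemma walk_ends_finite (x : V) (n : nat) : locally_finite E ->
  finite_set [set y | exists2 s, walk E x y s & size s = n].
Proof.
move=> Elf; elim: n => [|n IHn].
  apply: (@sub_finite_set _ _ [set x]); last exact: finite_set1.
  by move=> y [s [_ <-]] /size0nil ->.
apply: sub_finite_set (bigcup_finite IHn (fun z _ => Elf z)) => y [s].
case/lastP: s => // s z [/[!rcons_path] /andP[xs sz] /[!last_rcons] <-].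
by rewrite size_rcons => -[sn]; exists (last x s) => //; exists s.
Qed.

Lemma bounded_domain_finite (Omega : set V) :
  locally_finite E -> connected_graph E -> bounded_domain E Omega ->
  finite_set Omega.
Proof.
move=> Elf Econn [N distN].
have [->|/set0P[x0 Ox0]] := eqVneq Omega set0; first exact: finite_set0.
apply: sub_finite_set (bigcup_finite (finite_II N.+1)
  (fun n _ => @walk_ends_finite x0 n Elf)) => y Oy.
have [s xys sE] := @dist_walk x0 y Econn.
by exists (size s); [rewrite /= sE ltnS; exact: distN | exists s].
Qed.

Lemma boundary_finite (Omega : set V) :
  locally_finite E -> finite_set Omega -> finite_set (boundary E Omega).
Proof.
move=> Elf Ofin; apply: sub_finite_set (bigcup_finite Ofin (fun z _ => Elf z)).
by move=> y [_ [x Ox xy]]; exists x.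
Qed.

End FiniteDomain.

(** * Tangent bounds for powers and for the exponential *)

Section Powers.
Context {R : realType}.
Implicit Types (x y p : R).

Lemma norm_powR_mul p x : 0 < p -> `| `|x| `^ (p - 1) * x| = `|x| `^ p.
Proof.
move=> p0; rewrite normrM (ger0_norm (powR_ge0 _ _)) mulrC.
by rewrite mulr_powRB1.
Qed.

Lemma powR_mul_mul p x : 0 < p -> `|x| `^ (p - 1) * x * x = `|x| `^ (p + 1).
Proof.
move=> p0; have q0 : 0 < p + 1 by rewrite addr_gt0.
have e : `|x| `^ (p + 1) = `|x| * `|x| `^ p.
  by rewrite -(@mulr_powRB1 R `|x| (p + 1)) ?normr_ge0// addrK.
rewrite e -(@mulr_powRB1 R `|x| p) ?normr_ge0// -mulrA -expr2.
by rewrite -(real_normK (num_real x)) expr2 mulrC mulrA.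
Qed.

(** The convex function |y|^(p+1) lies above its tangent at x.  Young's
    inequality for the conjugate exponents (p+1)/p and p+1, applied to |x|^p
    and |y|, proves this uniformly in the signs of x and y and also at x = 0. *)
Lemma powR_tangent p x y : 0 < p ->
  `|x| `^ (p + 1) + (p + 1) * (`|x| `^ (p - 1) * x * (y - x))
  <= `|y| `^ (p + 1).
Proof.
move=> p0; have q0 : 0 < p + 1 by rewrite addr_gt0.
have young := @conjugate_powR R (`|x| `^ p) `|y| ((p + 1) / p) (p + 1)
   (powR_ge0 _ _) (normr_ge0 _) (divr_gt0 q0 p0) q0.
have {}young : (p + 1) * (`|x| `^ p * `|y|)
    <= p * `|x| `^ (p + 1) + `|y| `^ (p + 1).
  rewrite -ler_pdivlMl//; apply: le_trans (young _) _.
    by field; apply/andP; split; lra.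
  rewrite -powRrM (_ : p * ((p + 1) / p) = p + 1); last by field; lra.
  rewrite le_eqVlt; apply/orP; left; apply/eqP; field.
  by apply/andP; split; lra.
have xy : `|x| `^ (p - 1) * x * y <= `|x| `^ p * `|y|.
  by rewrite -(norm_powR_mul p x)// -normrM ler_norm.
rewrite mulrBr powR_mul_mul//; nra.
Qed.

(** The tangents at x and at y bound the increment from both sides, and their
    slopes have absolute value at most (p+1) M^p. *)
Lemma powR_locally_lipschitz p x y M : 0 < p -> `|x| <= M -> `|y| <= M ->
  `| `|x| `^ (p + 1) - `|y| `^ (p + 1)| <= (p + 1) * M `^ p * `|x - y|.
Proof.
move=> p0.
wlog suff half : x y / `|x| <= M ->
    `|x| `^ (p + 1) - `|y| `^ (p + 1) <= (p + 1) * M `^ p * `|x - y|.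
  move=> xM yM; rewrite ler_norml half// andbT lerNl opprB distrC.
  exact: half.
move=> xM; have := powR_tangent p x y p0.
have slope : `|x| `^ (p - 1) * x * (x - y) <= M `^ p * `|x - y|.
  apply: le_trans (ler_norm _) _; rewrite normrM norm_powR_mul//.
  have M0 : 0 <= M := le_trans (normr_ge0 x) xM.
  by rewrite ler_wpM2r//; apply: ge0_ler_powR; rewrite ?nnegrE// ltW.
nra.
Qed.

Lemma normr_powR_continuous p : 0 < p -> continuous (fun x => `|x| `^ (p + 1)).
Proof.
move=> p0 x; apply/cvgrPdist_lt => e e0.
pose L := (p + 1) * (`|x| + 1) `^ p.
have L0 : 0 < L by rewrite mulr_gt0 ?powR_gt0 ?ltr_wpDl//; lra.
near=> y.
have xy1 : `|x - y| < 1 by near: y; exact: cvgr_dist_lt.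
have xyL : `|x - y| < e / L by near: y; apply: cvgr_dist_lt; rewrite ?divr_gt0.
apply: le_lt_trans (@powR_locally_lipschitz p x y (`|x| + 1) p0 _ _) _.
- by rewrite lerDl.
- by have := ler_distD x 0 y; rewrite !sub0r !normrN; lra.
- by rewrite -ltr_pdivlMl// mulrC.
Unshelve. all: by end_near. Qed.

(** A line that stays below a smooth curve and meets it at t = 0 is tangent to
    it there.  The exponent is (q/2) (N(v + t phi) - 1) when N(v) = 1,
    B = B(v, phi) and C = N(phi). *)
Lemma expR_line_contact (S q B C Q : R) : q != 0 ->
  (forall t, S + q * t * Q <= S * expR (q / 2 * (2 * t * B + t ^+ 2 * C))) ->
  S * B = Q.
Proof.
move=> q0 le_g.
pose g (t : R) : R :=
  S * expR (q / 2 * (2 * t * B + t ^+ 2 * C)) - S - q * t * Q.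
have dg (t : R) : is_derive t (1 : R) g
    (S * (expR (q / 2 * (2 * t * B + t ^+ 2 * C))
      * (q / 2 * (2 * B + 2 * t * C))) - q * Q).
  by apply: is_derive_eq; rewrite /GRing.scale/=; ring.
have itv0 : (0 : R) \in `](-1), 1[ by rewrite in_itv/= ltrN10 ltr01.
have le11 : (-1 : R) <= 1 by lra.
have gmin t : t \in `](-1), (1 : R)[ -> g 0 <= g t.
  have := le_g t.
  by rewrite /g !(mulr0, mul0r, expr0n)/= addr0 mulr0 expR0; lra.
have [_ g'0] := derive1_at_min le11 (fun t _ => @ex_derive _ _ _ _ _ _ _ (dg t))
  itv0 gmin.
have := @derive_val _ _ _ _ _ _ _ (dg 0); rewrite g'0.
rewrite !(mulr0, mul0r, expr0n)/= addr0 mulr0 expR0 => e.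
have {}e : q * (S * B - Q) = 0 by rewrite [RHS]e; field.
by move/eqP: e; rewrite mulf_eq0 (negPf q0) subr_eq0 => /eqP.
Qed.

End Powers.

(** * Continuity of pointwise operations *)

Section Continuity.
Context {R : realType} {T : topologicalType}.
Implicit Types f g : T -> R.

Lemma continuous_mul f g :
  continuous f -> continuous g -> continuous (fun x => f x * g x).
Proof. by move=> cf cg x; exact: (continuousM (cf x) (cg x)). Qed.

Lemma continuous_add f g :
  continuous f -> continuous g -> continuous (fun x => f x + g x).
Proof. by move=> cf cg x; exact: (continuousD (cf x) (cg x)). Qed.

Lemma continuous_sub f g :
  continuous f -> continuous g -> continuous (fun x => f x - g x).
Proof. by move=> cf cg x; exact: (continuousB (cf x) (cg x)). Qed.

Lemma continuous_scale (a : R) f :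
  continuous f -> continuous (fun x => a * f x).
Proof. by apply: continuous_mul; exact: cst_continuous. Qed.

Lemma continuous_sum {I : Type} (r : seq I) (F : I -> T -> R) :
  (forall i, continuous (F i)) -> continuous (fun x => \sum_(i <- r) F i x).
Proof.
move=> cF; apply: (@continuous_big R I +%R 0 xpredT (@add_continuous R)) => i _.
exact: cF.
Qed.

End Continuity.

(** * The quadratic form of the Sobolev norm *)

Section Energy.
Context {R : realType} {V : choiceType}.
Variables (E : rel V) (w : V -> V -> R) (mu : V -> R).
Implicit Types (u v phi : V -> R) (A Omega : set V).

(** The integral over A as a real number; meaningful for finite A, where it
    agrees with [integral_on] by [integral_onE]. *)
Definition mu_sum A u : R := \sum_(x <- fset_set A) mu x * u x.

Lemma integral_onE A u : finite_set A -> integral_on mu A u = (mu_sum A u)%:E.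
Proof.
move=> Afin; rewrite /integral_on !esum_fset//.
rewrite !fsbig_finite//= /mu_sum.
under eq_bigr do rewrite funeposE -EFin_max.
under [X in (_ - X)%E]eq_bigr do rewrite funenegE -EFinN -EFin_max.
rewrite !sumEFin -EFinB -sumrB; congr EFin; apply: eq_bigr => x _.
by case: (leP (mu x * u x) 0); case: (leP (- (mu x * u x)) 0); lra.
Qed.

Lemma mu_sum_linear A (a : R) u v :
  mu_sum A (fun x => u x + a * v x) = mu_sum A u + a * mu_sum A v.
Proof.
rewrite /mu_sum mulr_sumr -big_split/=; apply: eq_bigr => x _; ring.
Qed.

Lemma mu_sumZ A (a : R) u : mu_sum A (fun x => a * u x) = a * mu_sum A u.
Proof. by rewrite /mu_sum mulr_sumr; apply: eq_bigr => x _; ring. Qed.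

Lemma eq_mu_sum A u v : (forall x, u x = v x) -> mu_sum A u = mu_sum A v.
Proof. by move=> uv; apply: eq_bigr => x _; rewrite uv. Qed.

Hypothesis mu_pos : forall x, 0 < mu x.

Lemma mu_sum_le A u v : (forall x, u x <= v x) -> mu_sum A u <= mu_sum A v.
Proof.
by move=> uv; apply: ler_sum => x _; rewrite ler_wpM2l// ltW.
Qed.

Lemma mu_sum_ge0 A u : (forall x, 0 <= u x) -> 0 <= mu_sum A u.
Proof. by move=> u0; apply: sumr_ge0 => x _; rewrite mulr_ge0// ltW. Qed.

Lemma mu_sum_ge_term A u x : finite_set A -> A x -> (forall x, 0 <= u x) ->
  mu x * u x <= mu_sum A u.
Proof.
move=> Afin Ax u0.
have xA : x \in fset_set A by rewrite in_fset_set//; exact: mem_set.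
rewrite /mu_sum (big_fsetD1 x xA)/= lerDl.
by apply: sumr_ge0 => y _; rewrite mulr_ge0// ltW.
Qed.

Lemma mu_sum_continuous A (F : (V -> R) -> V -> R) :
  (forall x, continuous (fun u : {ptws V -> R} => F u x)) ->
  continuous (fun u : {ptws V -> R} => mu_sum A (F u)).
Proof.
move=> cF; apply: (@continuous_sum R {ptws V -> R} V (fset_set A)
  (fun x u => mu x * F u x)) => x.
exact: continuous_scale.
Qed.

Hypothesis E_lf : locally_finite E.

Lemma GammaE u v x : Gamma E w mu u v x =
  (2 * mu x)^-1 * \sum_(y <- fset_set (neighbours E x))
    w x y * (u y - u x) * (v y - v x).
Proof. by rewrite /Gamma fsbig_finite. Qed.

Lemma GammaC u v x : Gamma E w mu u v x = Gamma E w mu v u x.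
Proof.
by rewrite !GammaE; congr (_ * _); apply: eq_bigr => y _; rewrite mulrAC.
Qed.

Lemma Gamma_linear (a : R) u v phi x :
  Gamma E w mu (fun x => u x + a * v x) phi x =
  Gamma E w mu u phi x + a * Gamma E w mu v phi x.
Proof.
rewrite !GammaE (mulrCA a) -mulrDr; congr (_ * _).
rewrite mulr_sumr -big_split; apply: eq_bigr => y _ /=; ring.
Qed.

(** The inner product of W_0^{1,2}(Omega), whose diagonal is the squared norm. *)
Definition energy Omega u v : R :=
  mu_sum (Omega `|` boundary E Omega) (Gamma E w mu u v)
  + mu_sum Omega (fun x => u x * v x).

Lemma energyC Omega u v : energy Omega u v = energy Omega v u.
Proof.
by congr (_ + _); apply: eq_mu_sum => x; [exact: GammaC|exact: mulrC].
Qed.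

Lemma energy_linear_l Omega (a : R) u v phi :
  energy Omega (fun x => u x + a * v x) phi =
  energy Omega u phi + a * energy Omega v phi.
Proof.
rewrite /energy (eq_mu_sum _ _ _ (Gamma_linear a u v phi)) mu_sum_linear.
rewrite (@eq_mu_sum Omega _ (fun x => u x * phi x + a * (v x * phi x)))
  ?mu_sum_linear; first by ring.
by move=> x; ring.
Qed.

Lemma energy_scale Omega (a : R) u phi :
  energy Omega (fun x => a * u x) phi = a * energy Omega u phi.
Proof.
have sum0 (f : V -> R) b : (fun x => 0 + b * f x) = (fun x => b * f x).
  by apply/funext => x; rewrite add0r.
have z0 : energy Omega (fun=> 0) phi = 0.
  have := energy_linear_l Omega 1 (fun=> 0) (fun=> 0) phi.
  rewrite sum0 (_ : (fun=> 1 * 0) = (fun=> 0)); first by lra.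
  by apply/funext => x; rewrite mulr0.
by have := energy_linear_l Omega a (fun=> 0) u phi; rewrite sum0 z0 add0r.
Qed.

Lemma energy_line Omega (t : R) u v :
  let ut := fun x => u x + t * v x in
  energy Omega ut ut =
  energy Omega u u + 2 * t * energy Omega u v + t ^+ 2 * energy Omega v v.
Proof.
move=> ut; rewrite energy_linear_l (energyC _ u ut) (energyC _ v ut).
rewrite !energy_linear_l (energyC _ v u); ring.
Qed.

Hypothesis w_pos : forall x y, E x y -> 0 < w x y.

Lemma Gamma_ge0 u x : 0 <= Gamma E w mu u u x.
Proof.
rewrite GammaE; apply: mulr_ge0; first by rewrite invr_ge0 mulr_ge0// ltW.
rewrite big_seq; apply: sumr_ge0 => y; rewrite in_fset_set// in_setE => xy.
by rewrite -mulrA mulr_ge0 ?(ltW (w_pos _ _ xy))// -expr2 sqr_ge0.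
Qed.

Lemma energy_ge0 Omega u : 0 <= energy Omega u u.
Proof.
apply: addr_ge0; apply: mu_sum_ge0 => x; first exact: Gamma_ge0.
by rewrite -expr2 sqr_ge0.
Qed.

(** The energy controls each value of u; this bounds the unit sphere and shows
    that the energy is definite on functions supported in Omega. *)
Lemma energy_ge_term Omega u x : finite_set Omega -> Omega x ->
  mu x * u x ^+ 2 <= energy Omega u u.
Proof.
move=> Ofin Ox; rewrite /energy.
have := mu_sum_ge0 (Omega `|` boundary E Omega) _ (Gamma_ge0 u).
have := @mu_sum_ge_term Omega (fun x => u x ^+ 2) x Ofin Ox
  (fun x => sqr_ge0 _).
by rewrite /mu_sum; under [X in _ + X]eq_bigr do rewrite -expr2; lra.
Qed.

Lemma eval_continuous x : continuous (fun u : {ptws V -> R} => u x).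
Proof. exact: (@proj_continuous V (fun=> R) x). Qed.

Lemma energy_continuous Omega :
  continuous (fun u : {ptws V -> R} => energy Omega u u).
Proof.
apply: continuous_add; apply: mu_sum_continuous => x; last first.
  by apply: continuous_mul; exact: eval_continuous.
rewrite (_ : (fun u : {ptws V -> R} => _) = fun u => (2 * mu x)^-1 *
    \sum_(y <- fset_set (neighbours E x)) w x y * (u y - u x) * (u y - u x)).
  apply: continuous_scale; apply: (@continuous_sum R {ptws V -> R}) => y.
  by apply: continuous_mul; [apply: continuous_scale|];
     apply: continuous_sub; exact: eval_continuous.
by apply/funext => u; rewrite GammaE.
Qed.

End Energy.

(** * The maximiser on the unit sphere and the ground state *)

Section GroundState.
Context {R : realType} {V : choiceType}.
Variables (E : rel V) (w : V -> V -> R) (mu : V -> R) (p : R) (Omega : set V).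
Hypothesis E_lf : locally_finite E.
Hypothesis w_pos : forall x y, E x y -> 0 < w x y.
Hypothesis mu_pos : forall x, 0 < mu x.
Hypothesis Omega_fin : finite_set Omega.
Hypothesis p_gt1 : 1 < p.
Implicit Types (u v phi : V -> R).

Local Notation energy := (energy E w mu Omega).
Local Notation mu_sum := (mu_sum mu).

Definition supported u := forall x, ~ Omega x -> u x = 0.

Definition power_integral u : R := mu_sum Omega (fun x => `|u x| `^ (p + 1)).

Lemma normWE u : normW E w mu Omega u = (Num.sqrt (energy u u))%:E.
Proof.
have bd_fin : finite_set (Omega `|` boundary E Omega).
  by rewrite finite_setU; split=> //; exact: boundary_finite.
rewrite /normW !integral_onE// -EFinD poweR_EFin.
rewrite (_ : _ + _ = energy u u) ?powR12_sqrt//.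
by apply: energy_ge0.
Qed.

Lemma normW_sqr u : (normW E w mu Omega u ^+ 2)%E = (energy u u)%:E.
Proof. by rewrite normWE -EFin_expe sqr_sqrtr//; exact: energy_ge0. Qed.

Lemma integral_powE u : integral_pow mu p Omega u = (power_integral u)%:E.
Proof. exact: integral_onE. Qed.

Lemma CcE : Cc Omega = supported.
Proof.
apply/seteqP; split=> [phi [_ supp] x nOx|phi supp].
  by apply/eqP; apply: contra_notT nOx => /supp.
have sub : [set x | phi x != 0] `<=` Omega.
  by move=> x /eqP; apply: contra_notP => /supp.
by split=> //; exact: sub_finite_set Omega_fin.
Qed.

Lemma energy0 phi : energy (fun=> 0) phi = 0.
Proof.
by have := energy_scale E w mu E_lf Omega 0 (fun=> 0) phi; rewrite !mul0r.
Qed.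

(** With Omega finite, a function that vanishes outside Omega already has finite
    support, so the constant sequence approximates it. *)
Lemma W012E : W012 E w mu Omega = supported.
Proof.
apply/seteqP; split=> [u []//|u supp]; split=> //.
exists (fun=> u); split=> [n|]; first by rewrite CcE.
rewrite (_ : (fun _ => _) = cst 0%E); first exact: cvg_cst.
apply/funext => n; rewrite normWE (_ : u \- u = fun=> 0).
  by rewrite energy0 sqrtr0.
by apply/funext => x /=; rewrite subrr.
Qed.

Lemma supported_neq0 u : supported u -> u <> cst 0 ->
  exists2 x, Omega x & u x != 0.
Proof.
move=> usupp un0; apply: contrapT => nu; apply: un0; apply/funext => x.
have [Ox|/usupp//] := pselect (Omega x).
by apply/eqP; apply: contra_notT nu => ux; exists x.
Qed.

Lemma energy_gt0 u x : Omega x -> u x != 0 -> 0 < energy u u.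
Proof.
move=> Ox ux; apply: lt_le_trans (energy_ge_term E w mu mu_pos E_lf w_pos
  Omega u x Omega_fin Ox).
by rewrite mulr_gt0// exprn_even_gt0.
Qed.

Lemma power_integral_scale (t : R) u : 0 <= t ->
  power_integral (fun x => t * u x) = t `^ (p + 1) * power_integral u.
Proof.
move=> t0; rewrite /power_integral -mu_sumZ; apply: eq_mu_sum => x.
by rewrite normrM powRM// ger0_norm.
Qed.

Lemma power_integral_continuous :
  continuous (fun u : {ptws V -> R} => power_integral u).
Proof.
apply: mu_sum_continuous => x u.
apply: (@continuous_comp _ _ _ (fun u : {ptws V -> R} => u x)
  (fun y => `|y| `^ (p + 1))).
  exact: eval_continuous.
by apply: normr_powR_continuous; exact: lt_trans p_gt1.
Qed.

(** The topology is that of pointwise convergence on all of V, which makes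
    Tychonoff's theorem available without choosing coordinates on Omega. *)
Definition unit_sphere : set {ptws V -> R} :=
  [set u | supported u /\ energy u u = 1].

(** The sphere is a closed subset of the product of the sets [K x] below: on
    Omega, mu x * u x ^+ 2 <= 1, and off Omega the factor is a point. *)
Lemma unit_sphere_compact : compact unit_sphere.
Proof.
pose K x : set R :=
  if `[< Omega x >] then `[- (1 + (mu x)^-1), 1 + (mu x)^-1]%classic
  else [set 0].
have K_compact : compact [set u : {ptws V -> R} | forall x, K x (u x)].
  apply: (@tychonoff V (fun=> R)) => x; rewrite /K; case: ifP => _.
    exact: segment_compact.
  exact: compact_set1.
have sphere_closed : closed [set u : {ptws V -> R} | energy u u = 1].
  apply: (@preimage_closed _ _ (fun u : {ptws V -> R} => energy u u)
    [set x | x = 1]); last exact: closed_eq.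
  by move=> u _; exact: energy_continuous.
rewrite (_ : unit_sphere = [set u : {ptws V -> R} | forall x, K x (u x)]
    `&` [set u | energy u u = 1]); first exact: compact_closedI.
apply/seteqP; split=> u [Ku u1]; split=> // x; rewrite /K.
  case: asboolP => [Ox|/Ku//].
  have := energy_ge_term E w mu mu_pos E_lf w_pos Omega u x Omega_fin Ox.
  rewrite u1 -ler_pdivlMl// mulr1 => ux.
  (* |u x|^2 <= m implies |u x| <= 1 + m, which avoids a square root. *)
  have := real_normK (num_real (u x)); have := normr_ge0 (u x).
  by rewrite /= in_itv/= -ler_norml; nra.
by have := Ku x; rewrite /K; case: asboolP.
Qed.

(** The sharp constant of the embedding of W_0^{1,2} into L^{p+1}: it is
    attained by compactness on the sphere and extends to every u because both sides are
    homogeneous of degree p+1. *)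
Lemma best_constant : Omega !=set0 ->
  exists v, [/\ supported v, energy v v = 1, 0 < power_integral v &
    forall u, supported u ->
      power_integral u <= power_integral v * energy u u `^ ((p + 1) / 2)].
Proof.
have p10 : p + 1 != 0 by rewrite gt_eqF// addr_gt0// (lt_trans _ p_gt1).
have normalize u : supported u -> 0 < energy u u ->
    unit_sphere (fun x => (Num.sqrt (energy u u))^-1 * u x).
  move=> usupp e0; split=> [x /usupp ->|]; first by rewrite mulr0.
  rewrite energy_scale// energyC// energy_scale// mulrA -expr2 exprVn.
  by rewrite sqr_sqrtr ?mulVf ?gt_eqF// ltW.
case=> x0 Ox0.
have [v [vsupp v1] vmax] : exists2 v, unit_sphere v &
    forall u, unit_sphere u -> power_integral u <= power_integral v.
  have [||v /set_mem vS vmax] := @compact_EVT_max _ R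
      (fun u : {ptws V -> R} => power_integral u) _ _ unit_sphere_compact.
  (* The sphere contains the normalised indicator of a point of Omega. *)
  - pose d x : R := (x == x0)%:R.
    have dsupp : supported d.
      by move=> x nOx; rewrite /d; case: eqP => // xx0; rewrite xx0 in nOx.
    eexists; apply: (normalize d dsupp).
    by apply: (energy_gt0 d x0 Ox0); rewrite /d eqxx oner_eq0.
  - by apply: continuous_subspaceT; exact: power_integral_continuous.
  - by exists v => // u uS; apply: vmax; exact: mem_set.
have S0 : 0 < power_integral v.
  have [|x Ox vx] := supported_neq0 v vsupp.
    by move=> v0; move/eqP: v1; rewrite v0 energy0 eq_sym oner_eq0.
  apply: lt_le_trans (mu_sum_ge_term mu mu_pos Omega
    (fun y => `|v y| `^ (p + 1)) x Omega_fin Ox (fun y => powR_ge0 _ _)).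
  by rewrite mulr_gt0// powR_gt0// normr_gt0.
exists v; split=> // u usupp; have [->|un0] := pselect (u = cst 0).
  rewrite {1}/power_integral /mu_sum big1 => [|x _].
    by rewrite mulr_ge0 ?powR_ge0//; apply: ltW; exact: S0.
  by rewrite normr0 powR0 ?mulr0.
have [x Ox ux] := supported_neq0 u usupp un0.
have e0 := energy_gt0 u x Ox ux.
have := vmax _ (normalize u usupp e0).
rewrite power_integral_scale ?invr_ge0 ?sqrtr_ge0//.
have -> : (Num.sqrt (energy u u))^-1 `^ (p + 1) =
    (energy u u `^ ((p + 1) / 2))^-1.
  rewrite -(@powR12_sqrt R (energy u u)) ?ltW// -!powRN -powRrM.
  by congr (_ `^ _); field.
by rewrite ler_pdivrMl ?powR_gt0// mulrC.
Qed.

(** The right-hand side of the weak equation; (p + 1) times it is the first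
    variation of [power_integral] at v in the direction phi. *)
Definition power_form v phi : R :=
  mu_sum Omega (fun x => `|v x| `^ (p - 1) * v x * phi x).

Lemma power_integral_line (t : R) v phi :
  power_integral v + (p + 1) * t * power_form v phi
  <= power_integral (fun x => v x + t * phi x).
Proof.
rewrite /power_integral /power_form -mu_sum_linear; apply: mu_sum_le => // x.
have := powR_tangent p (v x) (v x + t * phi x) (lt_trans ltr01 p_gt1).
rewrite addrAC subrr add0r; apply: le_trans.
by rewrite le_eqVlt; apply/orP; left; apply/eqP; ring.
Qed.

(** Along u = v + t phi, the chain
      P(v) + (p+1) t Q <= P(u) <= P(v) N(u)^((p+1)/2)
                       <= P(v) exp (((p+1)/2) (N(u) - 1)),
    where Q is [power_form v phi], starts and ends with the same value at t = 0,
    so the first derivatives of its two ends agree. *)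
Lemma euler_lagrange v phi :
  supported v -> energy v v = 1 -> 0 < power_integral v ->
  (forall u, supported u ->
     power_integral u <= power_integral v * energy u u `^ ((p + 1) / 2)) ->
  supported phi ->
  power_integral v * energy v phi = power_form v phi.
Proof.
move=> vsupp v1 S0 vmax phisupp.
have q0 : 0 < p + 1 by rewrite addr_gt0// (lt_trans _ p_gt1).
apply: (@expR_line_contact _ _ (p + 1) _ (energy phi phi)).
  by rewrite gt_eqF.
move=> t; pose ut x := v x + t * phi x.
have utsupp : supported ut.
  by move=> x nOx; rewrite /ut vsupp ?phisupp ?mulr0 ?addr0.
apply: le_trans (power_integral_line t v phi) _.
apply: le_trans (vmax _ utsupp) _.
have e0 : 0 <= energy ut ut by apply: energy_ge0.
rewrite ler_pM2l// [leRHS](_ : _ =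
  expR (2 * t * energy v phi + t ^+ 2 * energy phi phi) `^ ((p + 1) / 2)).
  apply: ge0_ler_powR; rewrite ?nnegrE ?expR_ge0//.
    by rewrite divr_ge0// ltW.
  by rewrite energy_line// v1 -addrA expR_ge1Dx.
by rewrite -expRM mulrC.
Qed.

Lemma weak_formE u phi :
  (integral_on mu (Omega `|` boundary E Omega) (Gamma E w mu u phi)
   + integral_on mu Omega (fun x => u x * phi x)%R)%E = (energy u phi)%:E.
Proof.
rewrite !integral_onE// finite_setU; split=> //; exact: boundary_finite.
Qed.

(** On the Nehari set, minimising J amounts to minimising the energy, since
    1/2 > 1/(p+1). *)
Lemma JE_Nehari u : Nehari E w mu p Omega u ->
  J E w mu p Omega u = ((2^-1 - (p + 1)^-1) * energy u u)%:E.
Proof.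
by case=> _ _ Nu; rewrite /J -Nu normW_sqr -!EFinM -EFinB mulrBl.
Qed.

(** The two sides of the weak equation are homogeneous in u of the different
    degrees 1 and p, so a suitable factor t absorbs the multiplier S in the
    Euler-Lagrange equation of the maximiser v. *)
Lemma ground_state_of_finite_domain : Omega !=set0 ->
  exists u0, ground_state_solution E w mu p Omega u0.
Proof.
move=> /best_constant[v [vsupp v1 S0 vmax]].
have p0 : 0 < p := lt_trans ltr01 p_gt1.
have p10 : 0 < p - 1 by rewrite subr_gt0.
set S := power_integral v in S0 vmax.
pose t := S `^ (- (p - 1)^-1).
have t0 : 0 < t by exact: powR_gt0.
have tS : t `^ (p - 1) = S^-1.
  by rewrite -powRrM mulNr mulVf ?gt_eqF// powR_inv1// ltW.
have tS2 : t `^ (p + 1) * S = t * t.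
  have := powR_mul_mul p t p0; rewrite gtr0_norm// => <-.
  by rewrite tS; field; rewrite gt_eqF.
pose u0 x := t * v x.
have u0supp : supported u0 by move=> x /vsupp; rewrite /u0 => ->; rewrite mulr0.
have e0 : energy u0 u0 = t * t.
  by rewrite energy_scale// energyC// energy_scale// v1 mulr1.
have u0N : Nehari E w mu p Omega u0.
  split; first by rewrite W012E.
    move=> u00; move: e0; rewrite u00 energy0 => /esym/eqP.
    by rewrite mulf_eq0 orbb gt_eqF.
  by rewrite normW_sqr integral_powE e0 power_integral_scale ?(ltW t0)// tS2.
have u0_min u : Nehari E w mu p Omega u -> t * t <= energy u u.
  case; rewrite W012E normW_sqr integral_powE => usupp un0 [Nu].
  have [x Ox ux] := supported_neq0 u usupp un0.
  have ep := energy_gt0 u x Ox ux; set e := energy u u in Nu ep *.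
  have := vmax u usupp; rewrite -Nu -/e.
  have -> : e `^ ((p + 1) / 2) = e * e `^ ((p - 1) / 2).
    rewrite -(@mulr_powRB1 R e ((p + 1) / 2)) ?ltW//; last first.
      by rewrite divr_gt0// addr_gt0.
    by congr (_ * _ `^ _); field.
  rewrite mulrCA ler_pMr// => le1.
  (* le1 says 1/S <= e^((p-1)/2), whereas e < t^2 would give
     e^((p-1)/2) < t^(p-1) = 1/S. *)
  rewrite leNgt; apply/negP => et.
  have p120 : 0 < (p - 1) / 2 by rewrite divr_gt0.
  have := @gt0_ltr_powR R _ p120 e (t * t).
  rewrite !nnegrE mulr_ge0 ?(ltW t0) ?(ltW ep)// => /(_ isT isT et).
  rewrite powRM ?(ltW t0)// -powRD; last by rewrite (gt_eqF t0) implybT.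
  rewrite (_ : (p - 1) / 2 + _ = p - 1) ?tS; last by field.
  by rewrite -[S^-1]div1r ltr_pdivlMr// mulrC ltNge le1.
exists u0; split=> //.
  split; first by rewrite W012E.
  move=> phi; rewrite CcE => phisupp.
  rewrite weak_formE integral_onE// energy_scale//; congr EFin.
  transitivity (S^-1 * t * power_form v phi).
    rewrite -(euler_lagrange v phi vsupp v1 S0 vmax phisupp).
    by rewrite -/S; field; rewrite gt_eqF.
  rewrite /power_form -mu_sumZ; apply: eq_mu_sum => x.
  by rewrite /u0 normrM powRM// (gtr0_norm t0) tS; ring.
apply/eqP; rewrite eq_le; apply/andP; split.
  apply: le_ereal_inf_tmp => _ [u uN <-]; rewrite !JE_Nehari// lee_fin e0.
  rewrite ler_wpM2l ?u0_min// subr_ge0 lef_pV2 ?posrE ?addr_gt0//; lra.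
by apply: ereal_inf_lbound; exists u0.
Qed.

End GroundState.

Theorem theorem1p2 (R : realType) (V : choiceType) (E : rel V)
    (w : V -> V -> R) (mu : V -> R) (p : R) (Omega : set V)
    (E_sym : symmetric E)
    (E_lf : locally_finite E)
    (E_conn : connected_graph E)
    (w_pos : forall x y, E x y -> 0 < w x y)
    (w_sym : forall x y, E x y -> w x y = w y x)
    (mu_pos : forall x, 0 < mu x)
    (mu_unif : uniformly_positive mu)
    (p_ge2 : 2 <= p)
    (Omega_neq0 : Omega !=set0)
    (Omega_conn : connected_in E Omega)
    (Omega_bnd : bounded_domain E Omega) :
  exists u0 : V -> R, ground_state_solution E w mu p Omega u0.
Proof.
apply: ground_state_of_finite_domain => //; last by lra.
exact: bounded_domain_finite Omega_bnd.
Qed.
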